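(* Let $I$ be a directed set and let $\langle T_i\ (i\in I);\ \Phi_i^j\ (i\le j)\rangle$ be a successful direct system of multi-embeddings, $T_i=\langle A_i,\mathcal F_i,D_i,G_i,\varphi_i\rangle$. Let $T^*=\langle A^*,\mathcal F^*,D^*,G^*,\varphi^*\rangle$ be its direct limit with canonical maps $\Phi_i:T_i\to T^*$. Then $\mathcal F^*$ (identified with a family of subsets of $A^*$) is homogeneous, $\varphi^*$ is defined on every demand in $D^*=D(A^*,\mathcal F^* )$ and $\varphi^*(d)\in G^*\subseteq\mathrm{Aut}(\mathcal F^* )$ satisfies $d$ for every $d\in D^*$ (so $\varphi^*$ testifies the homogeneity of $\mathcal F^*$), and each canonical map $\Phi_i:T_i\to T^*$ is a successful multi-embedding.
   Context: For $\mathcal F\subseteq\mathcal P(A)$: $\mathrm{Aut}(\mathcal F)$ is the group of permutations $\sigma$ of $A$ with $X\in\mathcal F\iff\sigma[X]\in\mathcal F$ for all $X\subseteq A$. A demand on $\mathcal F$ is a pair $d=(h^d,f^d)$, $h^d$ a finite injective partial function $A\to A$, $f^d$ a finite injective partial function $\mathcal F\to\mathcal F$, with $x\in X\iff h^d(x)\in f^d(X)$ for $x\in\mathrm{dom}\,h^d$, $X\in\mathrm{dom}\,f^d$; $D(A,\mathcal F)$ is the set of demands; $g\in\mathrm{Aut}(\mathcal F)$ satisfies $d$ if $g\supseteq h^d$ and $g[X]=f^d(X)$ for $X\in\mathrm{dom}\,f^d$. $\mathcal F$ is homogeneous if every demand is satisfied by some automorphism. A structure $T=\langle A,\mathcal F,D,G,\varphi\rangle$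 consists of a set $A$, $\mathcal F\subseteq\mathcal P(A)$, $D=D(A,\mathcal F)$, a subgroup $G\le\mathrm{Aut}(\mathcal F)$, and a partial satisfying homomorphism $\varphi$: a group homomorphism from the subgroup of the free group on $D$ generated by a subset $\mathrm{dom}\,\varphi\subseteq D$ into $G$ such that $\varphi(d)$ satisfies $d$ for all $d\in\mathrm{dom}\,\varphi$. Let $\bar T=A\cup\mathcal F\cup D\cup G$. A multi-embedding $\Phi:T_0\to T_1$ is a function on $\bar T_0$ such that $\Phi\restriction A_0$, $\Phi\restriction\mathcal F_0$, $\Phi\restriction D_0$ are injections into $A_1,\mathcal F_1,D_1$ respectively, $\Phi\restriction G_0$ is a group monomorphism into $G_1$, and for $x\in A_0,X\in\mathcal F_0,d\in D_0,g\in G_0$: (a) $x\in X\iff\Phi(x)\in\Phi(X)$; (b) $\Phi[\mathrm{dom}\,h^d]=\mathrm{dom}\,h^{\Phi(d)}$, $\Phi[\mathrm{dom}\,f^d]=\mathrm{dom}\,f^{\Phi(d)}$, $\Phi(h^d(x))=h^{\Phi(d)}(\Phi(x))$, $\Phi(f^d(X))=f^{\Phi(d)}(\Phi(X))$; (c) $\Phi(g(x))=\Phi(g)(\Phi(x))$ and $\Phi(g[X])=\Phi(g)[\Phi(X)]$; (d) if $d\in\mathrm{dom}\,\varphi_0$ then $\Phi(d)\in\mathrm{dom}\,\varphi_1$ and $\Phi(\varphi_0(d))=\varphi_1(\Phi(d))$. $\Phi$ is successful if moreover $\Phi(d)\in\mathrm{dom}\,\varphi_1$ for every $d\in D_0$.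 A direct system of multi-embeddings over a directed set $I$ consists of structures $T_i$ and multi-embeddings $\Phi_i^j:T_i\to T_j$ for $i\le j$ with $\Phi_i^i=\mathrm{id}$ and $\Phi_j^k\Phi_i^j=\Phi_i^k$ for $i\le j\le k$; it is successful if for every $i$ there is $j\ge i$ with $\Phi_i^j$ successful. Its direct limit $T^*$ is formed sortwise as the usual direct limit: $A^*=\bigsqcup_iA_i/\!\sim$ where $a\in A_i$, $b\in A_j$ are equivalent iff $\Phi_i^k(a)=\Phi_j^k(b)$ for some $k\ge i,j$, and similarly $\mathcal F^*,D^*,G^*$; $\Phi_i$ sends an element to its class; membership, the action of $G^*$, the components of demands, the group operation of $G^*$ and $\varphi^*$ are defined via representatives (e.g. $\Phi_i(x)\in\Phi_i(X)\iff x\in X$, $\varphi^*(\Phi_i(d))=\Phi_i(\varphi_i(d))$ for $d\in\mathrm{dom}\,\varphi_i$), each element of $\mathcal F^*$ being identified with its set of members in $A^*$. *)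

(* Defs.v *)
From HB Require Import structures.
From mathcomp Require Import all_boot all_order.
From mathcomp Require Import all_classical.

Set Implicit Arguments.
Unset Strict Implicit.
Unset Printing Implicit Defensive.

Import Order.TTheory.
Local Open Scope classical_set_scope.
Local Open Scope group_scope.

(* The symmetric group of an arbitrary (possibly infinite) set;
   multiplication is composition, [(g * h) x = g (h x)]. *)
Record perm (A : Type) := Perm { perm_fun :> A -> A; perm_bij : bijective perm_fun }.

HB.instance Definition _ (A : Type) := gen_eqMixin (perm A).
HB.instance Definition _ (A : Type) := gen_choiceMixin (perm A).

Lemma permP (A : Type) (g h : perm A) : (forall x, g x = h x) -> g = h.
Proof.
case: g h => [g gb] [h hb] /= /funext gh; rewrite gh in gb *.
by congr Perm; exact: Prop_irrelevance.
Qed.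

Section PermGroup.
Context {A : Type}.
Implicit Types g h : perm A.

Definition perm_one : perm A := Perm (Bijective (frefl id) (frefl id)).

Definition perm_mul g h : perm A := Perm (bij_comp (perm_bij g) (perm_bij h)).

Lemma perm_inv_exists g : exists h : perm A, cancel g h /\ cancel h g.
Proof. by case: (perm_bij g) => h gK hK; exists (Perm (Bijective hK gK)). Qed.

Definition perm_inv g : perm A := sval (cid (perm_inv_exists g)).

Lemma perm_mulA : associative perm_mul.
Proof. by move=> g h k; exact: permP. Qed.
Lemma perm_mul1 : left_id perm_one perm_mul.
Proof. by move=> g; exact: permP. Qed.
Lemma perm_1mul : right_id perm_one perm_mul.
Proof. by move=> g; exact: permP. Qed.
Lemma perm_mulV : left_inverse perm_one perm_inv perm_mul.
Proof.
by move=> g; apply: permP => x; rewrite /perm_inv; case: cid => h [gK hK] /=.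
Qed.
Lemma perm_mulVr : right_inverse perm_one perm_inv perm_mul.
Proof.
by move=> g; apply: permP => x; rewrite /perm_inv; case: cid => h [gK hK] /=.
Qed.
End PermGroup.

HB.instance Definition _ (A : Type) := isGroup.Build (perm A)
  (@perm_mulA A) (@perm_mul1 A) (@perm_1mul A) (@perm_mulV A) (@perm_mulVr A).

Definition is_subgroup (G : groupType) (H : set G) : Prop := group_closed [in H].

Definition generated (G : groupType) (S : set G) : set G :=
  smallest (@is_subgroup G) S.

(* The free group on [X], as the reduced words over the letters [(x, true)]
   (standing for x) and [(x, false)] (standing for x^-1). *)
Section FreeGroup.
Variable X : choiceType.
Implicit Types (l : X * bool) (w : seq (X * bool)).

Definition letter_inv l : X * bool := (l.1, ~~ l.2).

Definition reduced w : bool := sorted (fun l l' => l' != letter_inv l) w.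

Definition cons_reduce l w :=
  if w is l' :: w' then if l' == letter_inv l then w' else l :: w else [:: l].

Definition reduce w := foldr cons_reduce [::] w.

Lemma letter_invK : involutive letter_inv.
Proof. by case=> x b; rewrite /letter_inv /= negbK. Qed.

Lemma cons_reduce_reduced l w : reduced w -> reduced (cons_reduce l w).
Proof.
rewrite /reduced; case: w => //= l' w pw; case: ifP => [_|/= -> //].
exact: path_sorted pw.
Qed.

Lemma foldr_reduced w w' : reduced w' -> reduced (foldr cons_reduce w' w).
Proof. by move=> rw'; elim: w => //= l w; exact: cons_reduce_reduced. Qed.

Lemma reduce_reduced w : reduced (reduce w).
Proof. exact: foldr_reduced. Qed.

Lemma reduce_id w : reduced w -> reduce w = w.
Proof.
rewrite /reduced /reduce; elim: w => //= l w IH pw.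
rewrite IH ?(path_sorted pw) //.
by case: w pw {IH} => //= l' w /andP[/negPf -> _].
Qed.

Lemma cons_reduceK l w : reduced w ->
  cons_reduce (letter_inv l) (cons_reduce l w) = w.
Proof.
rewrite /reduced; case: w => [|l' w] /=; first by rewrite letter_invK eqxx.
case: (eqVneq l' (letter_inv l)) => [->|ne] /=; last by rewrite letter_invK eqxx.
by case: w => //= l2 w /andP[/negPf ->].
Qed.

Lemma foldr_cons_reduce l w w' : reduced w' ->
  foldr cons_reduce w' (cons_reduce l w) = cons_reduce l (foldr cons_reduce w' w).
Proof.
move=> rw'; case: w => //= l' w; case: eqP => //= ->.
by rewrite -[X in cons_reduce X (cons_reduce _ _)]letter_invK cons_reduceK ?foldr_reduced.
Qed.

Lemma foldr_reduce w w' : reduced w' ->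
  foldr cons_reduce w' (reduce w) = foldr cons_reduce w' w.
Proof.
by move=> rw'; rewrite /reduce; elim: w => //= l w IH; rewrite foldr_cons_reduce// IH.
Qed.

Lemma reduce_catl w w' : reduce (reduce w ++ w') = reduce (w ++ w').
Proof. by rewrite /reduce !foldr_cat foldr_reduce// foldr_reduced. Qed.

Lemma reduce_catr w w' : reduce (w ++ reduce w') = reduce (w ++ w').
Proof.
by rewrite /reduce !foldr_cat -/(reduce w') -/(reduce (reduce w'))
           [reduce (reduce w')]reduce_id ?reduce_reduced.
Qed.

Definition word_inv w := rev (map letter_inv w).

Lemma reduce_word_inv w : reduce (word_inv w ++ w) = [::].
Proof.
rewrite /reduce /word_inv; elim: w => //= l w IH.
rewrite rev_cons cat_rcons foldr_cat /= -/(reduce w) cons_reduceK ?reduce_reduced//.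
by rewrite -foldr_cat.
Qed.

Definition free_group : Type := {w : seq (X * bool) | reduced w}.

HB.instance Definition _ := Choice.on free_group.
HB.instance Definition _ := SubType.on free_group.

Definition free_word w : free_group := exist _ (reduce w) (reduce_reduced w).

Definition free_one : free_group := free_word [::].
Definition free_mul (u v : free_group) : free_group := free_word (val u ++ val v).
Definition free_inv (u : free_group) : free_group := free_word (word_inv (val u)).

Lemma free_mulA : associative free_mul.
Proof. by move=> u v w; apply: val_inj; rewrite /= reduce_catl reduce_catr catA. Qed.
Lemma free_mul1 : left_id free_one free_mul.
Proof. by move=> u; apply: val_inj; rewrite /= reduce_id ?(valP u). Qed.
Lemma free_1mul : right_id free_one free_mul.
Proof. by move=> u; apply: val_inj; rewrite /= cats0 reduce_id ?(valP u). Qed.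
Lemma free_mulV : left_inverse free_one free_inv free_mul.
Proof. by move=> u; apply: val_inj; rewrite /= reduce_catl reduce_word_inv. Qed.
Lemma free_mulVr : right_inverse free_one free_inv free_mul.
Proof.
move=> u; rewrite -[LHS]free_mul1 -[X in free_mul X _](free_mulV (free_inv u)).
by rewrite -free_mulA [X in free_mul _ X]free_mulA free_mulV free_mul1 free_mulV.
Qed.

HB.instance Definition _ := isGroup.Build free_group
  free_mulA free_mul1 free_1mul free_mulV free_mulVr.

Definition free_gen (x : X) : free_group := free_word [:: (x, true)].
End FreeGroup.

Definition letter_value (X : choiceType) (H : groupType) (f : X -> H)
  (l : X * bool) : H := if l.2 then f l.1 else (f l.1)^-1.

(* The homomorphic extension of [f] to the free group. *)
Definition free_extension (X : choiceType) (H : groupType) (f : X -> H)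
  (u : free_group X) : H := \prod_(l <- val u) letter_value f l.

(* Partial functions are represented by their graphs. *)
Definition graph_dom (T U : Type) (r : set (T * U)) : set T :=
  [set x | exists y, r (x, y)].

Definition finite_partial_injection (T : Type) (r : set (T * T)) : Prop :=
  [/\ finite_set r,
      forall x y y', r (x, y) -> r (x, y') -> y = y'
    & forall x x' y, r (x, y) -> r (x', y) -> x = x'].

Record predemand (A : Type) := Predemand {
  pt_graph : set (A * A);
  set_graph : set (set A * set A) }.

HB.instance Definition _ (A : Type) := gen_eqMixin (predemand A).
HB.instance Definition _ (A : Type) := gen_choiceMixin (predemand A).

Definition is_demand (A : Type) (F : set (set A)) (d : predemand A) : Prop :=
  [/\ finite_partial_injection (pt_graph d),
      finite_partial_injection (set_graph d),
      forall X Y, set_graph d (X, Y) -> F X /\ F Y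
    & forall x y X Y, pt_graph d (x, y) -> set_graph d (X, Y) -> (X x <-> Y y)].

Definition demands (A : Type) (F : set (set A)) : set (predemand A) :=
  [set d | is_demand F d].

Definition Aut (A : Type) (F : set (set A)) : set (perm A) :=
  [set s | forall X, F X <-> F (s @` X)].

Definition satisfies (A : Type) (g : perm A) (d : predemand A) : Prop :=
  (forall x y, pt_graph d (x, y) -> g x = y) /\
  (forall X Y, set_graph d (X, Y) -> g @` X = Y).

Definition homogeneous (A : Type) (F : set (set A)) : Prop :=
  forall d, demands F d -> exists2 g, Aut F g & satisfies g d.

(* The data of a structure <A, F, D, G, phi>. The subgroup of the free group on
   D generated by dom phi is [phi_subgroup]; the values of [phi] outside of it
   are irrelevant. *)
Record prestructure := Prestructure {
  pt : Type;
  fam : set (set pt);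
  dem : set (predemand pt);
  grp : set (perm pt);
  phi_dom : set dem;
  phi : free_group dem -> perm pt }.

Arguments fam T : clear implicits, rename.
Arguments dem T : clear implicits, rename.
Arguments grp T : clear implicits, rename.

Definition phi_subgroup (T : prestructure) : set (free_group (dem T)) :=
  generated (@free_gen (dem T) @` @phi_dom T).

Arguments phi_subgroup T : clear implicits.

Definition is_structure (T : prestructure) : Prop :=
  [/\ dem T = demands (fam T),
      grp T `<=` Aut (fam T) /\ is_subgroup (grp T),
      forall u, phi_subgroup T u -> grp T (phi u),
      forall u v, phi_subgroup T u -> phi_subgroup T v ->
        phi (u * v) = phi u * phi v
    & forall d : dem T, phi_dom d -> satisfies (phi (free_gen d)) (val d)].

Record structure := Structure {
  structure_data :> prestructure;
  structureP : is_structure structure_data }.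

(* A function on the disjoint union of the sorts A, F, D and G. *)
Record multi_map (T0 T1 : prestructure) := MultiMap {
  on_pt : pt T0 -> pt T1;
  on_fam : fam T0 -> fam T1;
  on_dem : dem T0 -> dem T1;
  on_grp : grp T0 -> grp T1 }.

Section MultiEmbedding.
Variables (T0 T1 : prestructure) (Phi : multi_map T0 T1).

Definition injective_on_sorts : Prop :=
  [/\ injective (on_pt Phi), injective (on_fam Phi), injective (on_dem Phi)
    & injective (on_grp Phi)].

(* Stated relationally, here and below, so as not to need the group operation of
   G and the action of G on F as operations on the subtypes. *)
Definition preserves_product : Prop := forall g h k : grp T0,
  val k = val g * val h ->
  val (on_grp Phi k) = val (on_grp Phi g) * val (on_grp Phi h).

Definition preserves_membership : Prop := forall (x : pt T0) (X : fam T0),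
  val X x <-> val (on_fam Phi X) (on_pt Phi x).

Definition preserves_demands : Prop := forall d : dem T0,
  [/\ on_pt Phi @` graph_dom (pt_graph (val d)) =
        graph_dom (pt_graph (val (on_dem Phi d))),
      [set val (on_fam Phi X) | X in
          [set X : fam T0 | graph_dom (set_graph (val d)) (val X)]] =
        graph_dom (set_graph (val (on_dem Phi d))),
      forall x y, pt_graph (val d) (x, y) ->
        pt_graph (val (on_dem Phi d)) (on_pt Phi x, on_pt Phi y)
    & forall X Y : fam T0, set_graph (val d) (val X, val Y) ->
        set_graph (val (on_dem Phi d)) (val (on_fam Phi X), val (on_fam Phi Y))].

Definition preserves_action : Prop := forall g : grp T0,
  (forall x, on_pt Phi (val g x) = val (on_grp Phi g) (on_pt Phi x)) /\
  (forall X Y : fam T0, val Y = val g @` val X ->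
     val (on_fam Phi Y) = val (on_grp Phi g) @` val (on_fam Phi X)).

Definition preserves_phi : Prop := forall d : dem T0, phi_dom d ->
  phi_dom (on_dem Phi d) /\
  forall g : grp T0, val g = phi (free_gen d) ->
    val (on_grp Phi g) = phi (free_gen (on_dem Phi d)).

Definition multi_embedding : Prop :=
  [/\ injective_on_sorts /\ preserves_product, preserves_membership,
      preserves_demands, preserves_action & preserves_phi].

Definition successful_embedding : Prop :=
  multi_embedding /\ forall d : dem T0, phi_dom (on_dem Phi d).
End MultiEmbedding.

Definition directed (disp : Order.disp_t) (I : preorderType disp) : Prop :=
  inhabited I /\ forall i j : I, exists k, (i <= k)%O /\ (j <= k)%O.

Record dir_sets (disp : Order.disp_t) (I : preorderType disp) := DirSets {
  obj : I -> Type;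
  tr : forall i j, (i <= j)%O -> obj i -> obj j;
  tr_id : forall i (ii : (i <= i)%O) x, tr ii x = x;
  tr_comp : forall i j k (ij : (i <= j)%O) (jk : (j <= k)%O) (ik : (i <= k)%O) x,
    tr jk (tr ij x) = tr ik x }.

Section DirectLimitOfSets.
Variables (disp : Order.disp_t) (I : preorderType disp) (dirI : directed I).
Variable S : dir_sets I.

Definition lim_carrier : Type := {i : I & obj S i}.

Definition lim_rel (p q : {classic lim_carrier}) : bool :=
  `[< exists (k : I) (pk : (tag p <= k)%O) (qk : (tag q <= k)%O),
        tr pk (tagged p) = tr qk (tagged q) >].

Lemma lim_rel_equiv : equiv_class_of lim_rel.
Proof.
split.
- by move=> p; apply/asboolP; exists (tag p), (lexx _), (lexx _).
- by move=> p q; apply/asboolP/asboolP => -[k [pk [qk e]]]; exists k, qk, pk.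
- move=> q p r /asboolP[k [pk [qk e]]] /asboolP[l [ql [rl f]]]; apply/asboolP.
  have [m [km lm]] := dirI.2 k l.
  exists m, (le_trans pk km), (le_trans rl lm).
  rewrite -(tr_comp pk km) e (tr_comp _ _ (le_trans qk km)).
  by rewrite -(tr_comp rl lm) -f (tr_comp _ _ (le_trans qk km)).
Qed.

Canonical lim_equiv := EquivRelPack lim_rel_equiv.

Definition dirlim : Type := {eq_quot lim_equiv}%qT.

Definition cls (i : I) (x : obj S i) : dirlim :=
  (\pi_{eq_quot lim_equiv} (existT _ i x))%qT.
End DirectLimitOfSets.

Record direct_system (disp : Order.disp_t) (I : preorderType disp) := DirectSystem {
  str : I -> structure;
  trans : forall i j, (i <= j)%O -> multi_map (str i) (str j);
  trans_embedding : forall i j (ij : (i <= j)%O), multi_embedding (trans ij);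
  trans_id : forall i (ii : (i <= i)%O),
    trans ii = MultiMap id id id id;
  trans_comp : forall i j k (ij : (i <= j)%O) (jk : (j <= k)%O) (ik : (i <= k)%O),
    trans ik = MultiMap (on_pt (trans jk) \o on_pt (trans ij))
                         (on_fam (trans jk) \o on_fam (trans ij))
                         (on_dem (trans jk) \o on_dem (trans ij))
                         (on_grp (trans jk) \o on_grp (trans ij)) }.

Definition successful_system (disp : Order.disp_t) (I : preorderType disp)
    (S : direct_system I) : Prop :=
  forall i, exists j, exists ij : (i <= j)%O, successful_embedding (trans S ij).

Section DirectLimit.
Variables (disp : Order.disp_t) (I : preorderType disp) (dirI : directed I).
Variable S : direct_system I.
Local Notation T := (str S).

Definition pt_sets : dir_sets I.
Proof.
refine (@DirSets _ I (fun i => pt (T i)) (fun i j ij => on_pt (trans S ij)) _ _).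
- by move=> i ii x; rewrite trans_id.
- by move=> i j k ij jk ik x; rewrite (trans_comp S ij jk ik).
Defined.

Definition fam_sets : dir_sets I.
Proof.
refine (@DirSets _ I (fun i => fam (T i)) (fun i j ij => on_fam (trans S ij)) _ _).
- by move=> i ii x; rewrite trans_id.
- by move=> i j k ij jk ik x; rewrite (trans_comp S ij jk ik).
Defined.

Definition dem_sets : dir_sets I.
Proof.
refine (@DirSets _ I (fun i => dem (T i)) (fun i j ij => on_dem (trans S ij)) _ _).
- by move=> i ii x; rewrite trans_id.
- by move=> i j k ij jk ik x; rewrite (trans_comp S ij jk ik).
Defined.

Definition grp_sets : dir_sets I.
Proof.
refine (@DirSets _ I (fun i => grp (T i)) (fun i j ij => on_grp (trans S ij)) _ _).
- by move=> i ii x; rewrite trans_id.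
- by move=> i j k ij jk ik x; rewrite (trans_comp S ij jk ik).
Defined.

Definition lim_pt : Type := dirlim dirI pt_sets.
Definition lim_fam : Type := dirlim dirI fam_sets.
Definition lim_dem : Type := dirlim dirI dem_sets.
Definition lim_grp : Type := dirlim dirI grp_sets.

Definition cls_pt (i : I) (x : pt (T i)) : lim_pt := @cls _ _ dirI pt_sets i x.
Definition cls_fam (i : I) (X : fam (T i)) : lim_fam := @cls _ _ dirI fam_sets i X.
Definition cls_dem (i : I) (d : dem (T i)) : lim_dem := @cls _ _ dirI dem_sets i d.
Definition cls_grp (i : I) (g : grp (T i)) : lim_grp := @cls _ _ dirI grp_sets i g.

(* [members], [components] and [action] identify the elements of the limit sorts
   with subsets of A*, demands on F* and permutations of A*, read off from
   representatives. The product of the classes of [g] and [h] in one T i, the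
   class of [g * h], then becomes composition. *)
Definition members (Y : lim_fam) : set lim_pt :=
  [set y | exists (i : I) (x : pt (T i)) (X : fam (T i)),
     [/\ y = cls_pt x, Y = cls_fam X & val X x]].

Definition components (e : lim_dem) : predemand lim_pt := Predemand
  [set p | exists (i : I) (d : dem (T i)) (x y : pt (T i)),
     [/\ e = cls_dem d, pt_graph (val d) (x, y) & p = (cls_pt x, cls_pt y)]]
  [set p | exists (i : I) (d : dem (T i)) (X Y : fam (T i)),
     [/\ e = cls_dem d, set_graph (val d) (val X, val Y)
       & p = (members (cls_fam X), members (cls_fam Y))]].

(* The permutation of A* sending the class of [x] to the class of [g x], for
   every representative [g] of [c]; 1 is the default if there were none. *)
Definition action (c : lim_grp) : perm lim_pt :=
  xget 1 [set s : perm lim_pt | forall (i : I) (g : grp (T i)) (x : pt (T i)),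
            c = cls_grp g -> s (cls_pt x) = cls_pt (val g x)].

Definition can_fam (i : I) (X : fam (T i)) : range members :=
  exist _ (members (cls_fam X)) (mem_set (imageT members (cls_fam X))).
Definition can_dem (i : I) (d : dem (T i)) : range components :=
  exist _ (components (cls_dem d)) (mem_set (imageT components (cls_dem d))).
Definition can_grp (i : I) (g : grp (T i)) : range action :=
  exist _ (action (cls_grp g)) (mem_set (imageT action (cls_grp g))).

Definition lim_phi_dom : set (range components) :=
  [set e | exists (i : I) (d : dem (T i)), phi_dom d /\ e = can_dem d].

Definition lim_phi_gen (e : range components) : perm lim_pt :=
  xget 1 [set s : perm lim_pt | exists (i : I) (d : dem (T i)) (g : grp (T i)),
            [/\ phi_dom d, e = can_dem d, val g = phi (free_gen d)
              & s = val (can_grp g)]].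

(* Only a prestructure: that it satisfies [is_structure] has to be proved. *)
Definition limit : prestructure := @Prestructure
  lim_pt (range members) (range components) (range action)
  lim_phi_dom (free_extension lim_phi_gen).

Definition canonical_map (i : I) : multi_map (T i) limit :=
  @MultiMap (T i) limit (@cls_pt i) (@can_fam i) (@can_dem i) (@can_grp i).
End DirectLimit.

(* Main.v *)
(* A finite set of elements of a direct limit is represented at a single index,
   and membership, actions and the graphs of demands at that index are exactly
   those between the classes. Hence a demand on F*, being finite, is the class of
   a demand d on some F_i; success of the system puts an image of d in the domain
   of some phi_j, and the class of phi_j of that image satisfies the given
   demand. *)
Require Import Defs.
From mathcomp Require Import all_boot all_order.
From mathcomp Require Import all_classical.

Set Implicit Arguments.
Unset Strict Implicit.
Unset Printing Implicit Defensive.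

Import Order.TTheory.
Local Open Scope classical_set_scope.
Local Open Scope group_scope.

(** * Homomorphic extension of a map to the free group *)

Section FreeExtension.
Variables (X : choiceType) (H : groupType) (f : X -> H).

Lemma letter_valueV l : letter_value f (letter_inv l) = (letter_value f l)^-1.
Proof. by case: l => x [] //=; rewrite /letter_value/= invgK. Qed.

(** Reduction only deletes adjacent pairs of mutually inverse letters, whose values multiply to 1.
    As the free product is concatenation followed by [reduce], multiplicativity of the extension
    follows. *)
Lemma prod_reduce w :
  \prod_(l <- reduce w) letter_value f l = \prod_(l <- w) letter_value f l.
Proof.
elim: w => //= l w; rewrite big_cons => <-; case: (reduce w) => [|l' w'] /=.
  by rewrite big_seq1 big_nil mulg1.
case: eqP => [->|_]; last by rewrite big_cons.
by rewrite big_cons letter_valueV mulVKg.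
Qed.

Lemma free_extensionM : {morph free_extension f : u v / u * v}.
Proof. by move=> u v; rewrite /free_extension /= prod_reduce big_cat. Qed.

Lemma free_extension_gen x : free_extension f (free_gen x) = f x.
Proof. by rewrite /free_extension /= big_seq1. Qed.

Lemma free_extension_closed (K : set H) : is_subgroup K -> (forall x, K (f x)) ->
  forall u, K (free_extension f u).
Proof.
move=> subK Kf u; apply: set_mem; rewrite /free_extension.
elim/big_ind: _ => [|g h Kg Kh|[x b] _]; first by case: subK.
  exact: group_closedM subK g h Kg Kh.
case: b => /=; rewrite /letter_value /=; first exact: mem_set.
by apply: group_closedV subK _ _; exact: mem_set.
Qed.
End FreeExtension.

(** * Representatives in direct limits of sets *)

Section DirectLimitOfSets.
Variables (disp : Order.disp_t) (I : preorderType disp) (dirI : directed I).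

Section Classes.
Variable S : dir_sets I.
Local Notation cls := (@cls _ I dirI S _).

Lemma cls_eqP i j (x : obj S i) (y : obj S j) : cls x = cls y <->
  exists k (ik : (i <= k)%O) (jk : (j <= k)%O), tr ik x = tr jk y.
Proof.
split=> [/eqquotP/asboolP //|e].
by apply/eqquotP/asboolP.
Qed.

Lemma cls_tr i j (ij : (i <= j)%O) (x : obj S i) : cls (tr ij x) = cls x.
Proof.
apply/cls_eqP; exists j, (lexx j), ij; exact: tr_id.
Qed.

(** Any representative can be pushed to an upper bound of its own index and [i]. Repeated use along
    increasing indices brings several classes to one index. *)
Lemma cls_above i (y : dirlim dirI S) :
  exists j (_ : (i <= j)%O) (x : obj S j), y = cls x.
Proof.
have [[j x] <-] : exists p, \pi_({eq_quot lim_equiv dirI S})%qT p = y.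
  by exists (repr y); rewrite reprK.
have [k [ik jk]] := dirI.2 i j.
by exists k, ik, (tr jk x); rewrite cls_tr.
Qed.

Lemma cls_inj i :
  (forall j (ij : (i <= j)%O), injective (tr ij : obj S i -> obj S j)) ->
  injective (fun x : obj S i => cls x).
Proof.
move=> tr_inj x y /cls_eqP[k [ik [ik']]].
by rewrite (Prop_irrelevance ik' ik); exact: tr_inj.
Qed.
End Classes.

(** Induction on an enumeration of [E]: each new element costs one upper bound, and monotonicity
    carries the earlier ones along. *)
Lemma finite_directed U (P : I -> U -> Prop) (E : set U) :
  (forall i j u, (i <= j)%O -> P i u -> P j u) ->
  finite_set E -> (forall u, E u -> exists i, P i u) ->
  exists i, forall u, E u -> P i u.
Proof.
(* [C] equips [U] with the equality test needed to list [E] as a sequence; [i0] serves for the empty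
   sequence. *)
move=> Pmono finE; have [i0] := dirI.1; pose C := {classic U}.
have /finite_seqP[s ->] : finite_set (E : set C) by [].
elim: s => [|u s IH] Pex; first by exists i0.
have [|i Pi] := IH; first by move=> v vs; apply: Pex; rewrite /= inE vs orbT.
have [|j Pj] := Pex u; first by rewrite /= inE eqxx.
have [k [ik jk]] := dirI.2 i j; exists k => v /=.
by rewrite inE => /orP[/eqP->|/Pi]; [exact: Pmono jk _|exact: Pmono ik].
Qed.
End DirectLimitOfSets.

(** * Transport of finite partial injections along injective maps *)

Lemma set_elt U (A : set U) x : A x -> exists y : A, val y = x.
Proof. by move=> Ax; exists (exist _ x (mem_set Ax)). Qed.

Lemma image_injective U V (f : U -> V) : injective f -> injective (image^~ f).
Proof.
move=> f_inj A B eAB; apply/seteqP; split=> x xA.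
  have [y By /f_inj <-//] : (f @` B) (f x) by rewrite -eAB; exists x.
by have [y Ay /f_inj <-//] : (f @` A) (f x) by rewrite eAB; exists x.
Qed.

Lemma pair_map_injective U V (f : U -> V) : injective f ->
  injective (fun p : U * U => (f p.1, f p.2)).
Proof. by move=> f_inj [x y] [x' y'] /= [/f_inj-> /f_inj->]. Qed.

Lemma finite_partial_injection_image U V (f : U -> V) (r : set (U * U)) :
  injective f -> finite_partial_injection r ->
  finite_partial_injection ((fun p => (f p.1, f p.2)) @` r).
Proof.
move=> f_inj [fin_r fun_r inj_r]; split; first exact: finite_image.
- move=> _ _ y' [[x y] rxy [<- <-]] [[x1 y1] rxy1 [/f_inj ex <-]].
  by rewrite /= in ex; congr f; apply: fun_r rxy _; rewrite -ex.
- move=> _ x' _ [[x y] rxy [<- <-]] [[x1 y1] rxy1 [<- /f_inj ey]].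
  by rewrite /= in ey; congr f; apply: inj_r rxy _; rewrite -ey.
Qed.

Lemma finite_partial_injection_preimage U V (f : U -> V) (r : set (V * V)) :
  injective f -> finite_partial_injection r ->
  finite_partial_injection ((fun p => (f p.1, f p.2)) @^-1` r).
Proof.
move=> f_inj [fin_r fun_r inj_r]; split.
- by apply: finite_preimage fin_r => p q _ _; exact: pair_map_injective.
- by move=> x y y' rxy rxy'; apply: f_inj; exact: fun_r rxy rxy'.
- by move=> x x' y rxy rxy'; apply: f_inj; exact: inj_r rxy rxy'.
Qed.

(** * Elements of the sorts of a structure *)

Section Structures.
Variable T : structure.

Lemma demE (d : predemand (pt T)) : dem T d <-> is_demand (fam T) d.
Proof. by have [demT _ _ _ _] := structureP T; rewrite demT. Qed.

Lemma dem_is_demand (d : dem T) : is_demand (fam T) (val d).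
Proof. by apply/demE; exact: set_mem (valP d). Qed.

Lemma fam_set_graph (d : dem T) X Y : set_graph (val d) (X, Y) ->
  exists X' Y' : fam T, X = val X' /\ Y = val Y'.
Proof.
have [_ _ dfam _ /dfam[FX FY]] := dem_is_demand d.
by exists (exist _ X (mem_set FX)), (exist _ Y (mem_set FY)).
Qed.

(** Multi-maps act on the subtype [grp T], so the identity, and likewise quotients, inverses and
    values of [phi] below, are needed as elements of that subtype. *)
Lemma grp_one : exists k : grp T, val k = 1.
Proof.
have [_ [_ [G1 _]] _ _ _] := structureP T.
by apply: set_elt; exact: set_mem.
Qed.

Lemma grp_div (g h : grp T) : exists k : grp T, val k = val g / val h.
Proof.
have [_ [_ [_ GD]] _ _ _] := structureP T; apply: set_elt.
by apply: set_mem; apply: GD; exact: valP.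
Qed.

Lemma grp_inv (g : grp T) : exists k : grp T, val k = (val g)^-1.
Proof.
have [e e1] := grp_one; have [k ek] := grp_div e g.
by exists k; rewrite ek e1 div1g.
Qed.

Lemma grp_fam (g : grp T) (X : fam T) : exists Y : fam T, val Y = val g @` val X.
Proof.
have [_ [GAut _] _ _ _] := structureP T; apply: set_elt.
exact: (GAut _ (set_mem (valP g)) (val X)).1 (set_mem (valP X)).
Qed.

Lemma grp_phi (d : dem T) : phi_dom d -> exists g : grp T, val g = phi (free_gen d).
Proof.
have [_ _ Gphi _ _] := structureP T => dd; apply: set_elt; apply: Gphi.
by apply: sub_gen_smallest; exists d.
Qed.
End Structures.

(** * Exact behaviour of multi-embeddings on demands and groups *)

Section Embedding.
Variables (T0 T1 : structure) (Phi : multi_map T0 T1).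
Hypothesis embPhi : multi_embedding Phi.

(** Clause (b) sends pairs to pairs. Conversely, the domains correspond and the graph of
    [on_dem Phi d] is functional, so it holds no further pair. *)
Lemma embedding_pt_graph (d : dem T0) : pt_graph (val (on_dem Phi d)) =
  (fun p => (on_pt Phi p.1, on_pt Phi p.2)) @` pt_graph (val d).
Proof.
have [_ _ demPhi _ _] := embPhi; have [domE _ ptPhi _] := demPhi d.
have [[_ fun_d _] _ _ _] := dem_is_demand (on_dem Phi d).
apply/seteqP; split=> [[x' y'] dxy|_ [[x y] /= /ptPhi ? <-//]].
have [x [y dxy0] ex] : (on_pt Phi @` graph_dom (pt_graph (val d))) x'.
  by rewrite domE; exists y'.
exists (x, y) => //=; rewrite ex; congr pair.
by apply: fun_d dxy; rewrite -ex; exact: ptPhi.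
Qed.

Lemma embedding_set_graph (d : dem T0) : set_graph (val (on_dem Phi d)) =
  (fun p : fam T0 * fam T0 => (val (on_fam Phi p.1), val (on_fam Phi p.2))) @`
    [set p : fam T0 * fam T0 | set_graph (val d) (val p.1, val p.2)].
Proof.
have [_ _ demPhi _ _] := embPhi; have [_ domE _ famPhi] := demPhi d.
have [_ [_ fun_d _] _ _] := dem_is_demand (on_dem Phi d).
apply/seteqP; split=> [[X' Y'] dXY|_ [[X Y] /= /famPhi ? <-//]].
have [X [Y dXY0] eX] : [set val (on_fam Phi X) | X in
    [set X : fam T0 | graph_dom (set_graph (val d)) (val X)]] X'.
  by rewrite domE; exists Y'.
(* [Y] is only known as a set; lying in the graph of a demand puts it in the family, where [on_fam]
   applies. *)
have [_ [Y1 [_ eY]]] := fam_set_graph dXY0; rewrite {}eY in dXY0.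
exists (X, Y1) => //=; rewrite eX; congr pair.
by apply: fun_d dXY; rewrite -eX; exact: famPhi.
Qed.

Lemma embedding_members (X : fam T0) x :
  val (on_fam Phi X) (on_pt Phi x) <-> val X x.
Proof. by have [_ memPhi _ _ _] := embPhi; split=> /memPhi. Qed.

Lemma embedding_grp_mul (g h k : grp T0) : val k = val g * val h ->
  val (on_grp Phi k) = val (on_grp Phi g) * val (on_grp Phi h).
Proof. by have [[_ mulPhi] _ _ _ _] := embPhi; exact: mulPhi. Qed.

(** The image is idempotent since 1 * 1 = 1, and an idempotent of a group is trivial. *)
Lemma embedding_grp_one (g : grp T0) : val g = 1 -> val (on_grp Phi g) = 1.
Proof.
move=> g1; apply: (mulgI (val (on_grp Phi g))); rewrite mulg1.
by rewrite -(@embedding_grp_mul g g g)// g1 mulg1.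
Qed.
End Embedding.

(** * Classes of points, sets, demands and group elements *)

Section Limit.
Variables (disp : Order.disp_t) (I : preorderType disp) (dirI : directed I).
Variable S : direct_system I.
Local Notation T := (str S).
Local Notation cls_pt := (@cls_pt _ I dirI S _).
Local Notation cls_fam := (@cls_fam _ I dirI S _).
Local Notation cls_dem := (@cls_dem _ I dirI S _).
Local Notation cls_grp := (@cls_grp _ I dirI S _).
Local Notation action := (@action _ I dirI S).
Local Notation members := (@members _ I dirI S).
Local Notation components := (@components _ I dirI S).

Lemma cls_pt_tr i j (ij : (i <= j)%O) (x : pt (T i)) :
  cls_pt (on_pt (trans S ij) x) = cls_pt x.
Proof. exact: (@cls_tr _ _ _ (pt_sets S)). Qed.

Lemma cls_fam_tr i j (ij : (i <= j)%O) (X : fam (T i)) :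
  cls_fam (on_fam (trans S ij) X) = cls_fam X.
Proof. exact: (@cls_tr _ _ _ (fam_sets S)). Qed.

Lemma cls_dem_tr i j (ij : (i <= j)%O) (d : dem (T i)) :
  cls_dem (on_dem (trans S ij) d) = cls_dem d.
Proof. exact: (@cls_tr _ _ _ (dem_sets S)). Qed.

Lemma cls_grp_tr i j (ij : (i <= j)%O) (g : grp (T i)) :
  cls_grp (on_grp (trans S ij) g) = cls_grp g.
Proof. exact: (@cls_tr _ _ _ (grp_sets S)). Qed.

Lemma cls_pt_eq i j (x : pt (T i)) (y : pt (T j)) : cls_pt x = cls_pt y ->
  exists k (ik : (i <= k)%O) (jk : (j <= k)%O),
    on_pt (trans S ik) x = on_pt (trans S jk) y.
Proof. by move/(@cls_eqP _ _ _ (pt_sets S)). Qed.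

Lemma cls_fam_eq i j (X : fam (T i)) (Y : fam (T j)) : cls_fam X = cls_fam Y ->
  exists k (ik : (i <= k)%O) (jk : (j <= k)%O),
    on_fam (trans S ik) X = on_fam (trans S jk) Y.
Proof. by move/(@cls_eqP _ _ _ (fam_sets S)). Qed.

Lemma cls_dem_eq i j (d : dem (T i)) (e : dem (T j)) : cls_dem d = cls_dem e ->
  exists k (ik : (i <= k)%O) (jk : (j <= k)%O),
    on_dem (trans S ik) d = on_dem (trans S jk) e.
Proof. by move/(@cls_eqP _ _ _ (dem_sets S)). Qed.

Lemma cls_grp_eq i j (g : grp (T i)) (h : grp (T j)) : cls_grp g = cls_grp h ->
  exists k (ik : (i <= k)%O) (jk : (j <= k)%O),
    on_grp (trans S ik) g = on_grp (trans S jk) h.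
Proof. by move/(@cls_eqP _ _ _ (grp_sets S)). Qed.

Lemma cls_pt_above i (y : lim_pt dirI S) :
  exists j (_ : (i <= j)%O) (x : pt (T j)), y = cls_pt x.
Proof. exact: (@cls_above _ _ _ (pt_sets S)). Qed.

Lemma cls_fam_above i (Y : lim_fam dirI S) :
  exists j (_ : (i <= j)%O) (X : fam (T j)), Y = cls_fam X.
Proof. exact: (@cls_above _ _ _ (fam_sets S)). Qed.

Lemma cls_dem_above i (e : lim_dem dirI S) :
  exists j (_ : (i <= j)%O) (d : dem (T j)), e = cls_dem d.
Proof. exact: (@cls_above _ _ _ (dem_sets S)). Qed.

Lemma cls_grp_above i (c : lim_grp dirI S) :
  exists j (_ : (i <= j)%O) (g : grp (T j)), c = cls_grp g.
Proof. exact: (@cls_above _ _ _ (grp_sets S)). Qed.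

Lemma cls_pt_inj i : injective (fun x : pt (T i) => cls_pt x).
Proof.
apply: (@cls_inj _ _ _ (pt_sets S)) => j ij.
by have [[[]]] := trans_embedding S ij.
Qed.

(** * Membership and graphs of demands in the limit *)

Lemma trans_trans i j k (ij : (i <= j)%O) (jk : (j <= k)%O) (ik : (i <= k)%O) :
  [/\ forall x, on_pt (trans S jk) (on_pt (trans S ij) x) = on_pt (trans S ik) x,
      forall X, on_fam (trans S jk) (on_fam (trans S ij) X) = on_fam (trans S ik) X
    & forall g, on_grp (trans S jk) (on_grp (trans S ij) g) = on_grp (trans S ik) g].
Proof. by rewrite (trans_comp S ij jk ik). Qed.

(** The representatives that witness membership may differ from [x] and [X], and agree with them
    only at two indices [k] and [l]. Above both, at [m], embeddings preserve and reflect
    membership. *)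
Lemma members_cls i (X : fam (T i)) (x : pt (T i)) :
  members (cls_fam X) (cls_pt x) <-> val X x.
Proof.
split=> [[j [x' [X' [/cls_pt_eq[k [ik [jk ex]]] /cls_fam_eq[l [il [jl eX]]] X'x']]]]|];
  last by exists i, x, X.
have [m [km lm]] := dirI.2 k l.
have im := le_trans ik km; have jm := le_trans jk km.
have [ptk _ _] := trans_trans ik km im; have [ptk' _ _] := trans_trans jk km jm.
have [_ faml _] := trans_trans il lm im; have [_ faml' _] := trans_trans jl lm jm.
apply/(embedding_members (trans_embedding S im)).
by rewrite -ptk -faml ex eX ptk' faml'; apply/embedding_members => //;
  exact: trans_embedding.
Qed.

Lemma members_cls_inj i : injective (fun X : fam (T i) => members (cls_fam X)).
Proof.
move=> X Y /= eXY; apply: val_inj; apply/funext => x; apply/propext.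
rewrite -(members_cls X) -(members_cls Y) eXY; exact: iff_refl.
Qed.

(** Another representative [e] of the class has the same image as [d] at some [k]. The graph there
    is exactly the image of either graph, so every pair from [e] also comes from [d]. *)
Lemma pt_graph_components i (d : dem (T i)) :
  pt_graph (components (cls_dem d)) =
  (fun p => (cls_pt p.1, cls_pt p.2)) @` pt_graph (val d).
Proof.
apply/seteqP; split=> [_ [j [e [x [y [/cls_dem_eq[k [ik [jk ede]]] exy ->]]]]]|];
  last by move=> _ [[x y] dxy <-]; exists i, d, x, y.
have : pt_graph (val (on_dem (trans S jk) e))
    (on_pt (trans S jk) x, on_pt (trans S jk) y).
  by rewrite (embedding_pt_graph (trans_embedding S jk)); exists (x, y).
rewrite -ede (embedding_pt_graph (trans_embedding S ik)) => -[[x' y'] dxy [ex ey]].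
by exists (x', y') => //=; rewrite -(cls_pt_tr ik) ex -(cls_pt_tr ik) ey !cls_pt_tr.
Qed.

Lemma set_graph_components i (d : dem (T i)) :
  set_graph (components (cls_dem d)) =
  (fun p : fam (T i) * fam (T i) =>
     (members (cls_fam p.1), members (cls_fam p.2))) @`
    [set p : fam (T i) * fam (T i) | set_graph (val d) (val p.1, val p.2)].
Proof.
apply/seteqP; split=> [_ [j [e [X [Y [/cls_dem_eq[k [ik [jk ede]]] exy ->]]]]]|];
  last by move=> _ [[X Y] dXY <-]; exists i, d, X, Y.
have : set_graph (val (on_dem (trans S jk) e))
    (val (on_fam (trans S jk) X), val (on_fam (trans S jk) Y)).
  by rewrite (embedding_set_graph (trans_embedding S jk)); exists (X, Y).
rewrite -ede (embedding_set_graph (trans_embedding S ik)) => -[[X' Y'] dXY e'].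
have eX : on_fam (trans S ik) X' = on_fam (trans S jk) X := val_inj (congr1 fst e').
have eY : on_fam (trans S ik) Y' = on_fam (trans S jk) Y := val_inj (congr1 snd e').
exists (X', Y') => //=.
by rewrite -(cls_fam_tr ik) eX -(cls_fam_tr ik) eY !cls_fam_tr.
Qed.

(** Both graphs are images under injective maps of pairs, hence can be recovered from their
    images. *)
Lemma components_cls_inj i : injective (fun d : dem (T i) => components (cls_dem d)).
Proof.
move=> d e /= ede; apply: val_inj.
have := congr1 (@pt_graph _) ede; rewrite !pt_graph_components => /image_injective ept.
have := congr1 (@set_graph _) ede; rewrite !set_graph_components => /image_injective eset.
have {}ept := ept (pair_map_injective (@cls_pt_inj i)).
have {}eset := eset (pair_map_injective (@members_cls_inj i)).
(* [eset] compares the graphs only on pairs from the family; a demand has no other pairs. *)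
have setE : set_graph (val d) = set_graph (val e).
  apply/seteqP; split=> -[X Y] gXY; have [X' [Y' [eX eY]]] := fam_set_graph gXY;
    rewrite {}eX {}eY in gXY *.
    by have : [set p : fam (T i) * fam (T i) | set_graph (val e) (val p.1, val p.2)]
      (X', Y') by rewrite -eset.
  by have : [set p : fam (T i) * fam (T i) | set_graph (val d) (val p.1, val p.2)]
    (X', Y') by rewrite eset.
by case: (val d) (val e) ept setE => [? ?] [? ?] /= -> ->.
Qed.

Lemma components_inj : injective components.
Proof.
move=> c c'; have [i0] := dirI.1.
have [i [_ [d0 ->]]] := cls_dem_above i0 c.
have [j [ij [e ->]]] := cls_dem_above i c'.
by rewrite -(cls_dem_tr ij d0) => /components_cls_inj->.
Qed.

(** * The group of the limit and its action *)

Lemma cls_pt_act i j (g : grp (T i)) (x : pt (T i)) (h : grp (T j)) (y : pt (T j)) :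
  cls_grp g = cls_grp h -> cls_pt x = cls_pt y ->
  cls_pt (val g x) = cls_pt (val h y).
Proof.
move=> /cls_grp_eq[k [ik [jk egh]]] /cls_pt_eq[l [il [jl exy]]].
(* At [m] the images of [g] and [h] coincide, as do those of [x] and [y], and the action commutes
   with the transition maps. *)
have [m [km lm]] := dirI.2 k l.
have im := le_trans ik km; have jm := le_trans jk km.
have [_ _ grpk] := trans_trans ik km im; have [_ _ grpk'] := trans_trans jk km jm.
have [ptl _ _] := trans_trans il lm im; have [ptl' _ _] := trans_trans jl lm jm.
have [_ _ _ actm _] := trans_embedding S im; have [_ _ _ actm' _] := trans_embedding S jm.
rewrite -(cls_pt_tr im) -(cls_pt_tr jm) (actm g).1 (actm' h).1.
by rewrite -grpk -grpk' egh -ptl -ptl' exy.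
Qed.

Lemma action_fun_exists (c : lim_grp dirI S) :
  exists s : lim_pt dirI S -> lim_pt dirI S,
    forall i (g : grp (T i)) (x : pt (T i)),
      c = cls_grp g -> s (cls_pt x) = cls_pt (val g x).
Proof.
suff /choice[s sP] : forall y, exists z, forall i (g : grp (T i)) (x : pt (T i)),
    c = cls_grp g -> y = cls_pt x -> z = cls_pt (val g x).
  by exists s => i g x cg; exact: sP.
move=> y; have [i0] := dirI.1.
have [i [_ [g0 ->]]] := cls_grp_above i0 c.
have [j [ij [x ->]]] := cls_pt_above i y.
exists (cls_pt (val (on_grp (trans S ij) g0) x)) => k h z eg ex.
by apply: cls_pt_act => //; rewrite cls_grp_tr.
Qed.

(** The default value of [action] is excluded by exhibiting a permutation: the functions induced by
    [g] and by its inverse [h] are mutually inverse. *)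
Lemma action_cls i (g : grp (T i)) (x : pt (T i)) :
  action (cls_grp g) (cls_pt x) = cls_pt (val g x).
Proof.
rewrite /Defs.action; case: xgetP => [s _ sP|no_s]; first exact: sP.
have [h hV] := grp_inv g; have [e e1] := grp_one (T i).
have [s sP] := action_fun_exists (cls_grp g).
have [t tP] := action_fun_exists (cls_grp h).
have cancelP (g1 g2 : grp (T i)) (s1 s2 : lim_pt dirI S -> lim_pt dirI S) :
    val g1 * val g2 = 1 ->
    (forall k (f : grp (T k)) (z : pt (T k)),
      cls_grp g1 = cls_grp f -> s1 (cls_pt z) = cls_pt (val f z)) ->
    (forall k (f : grp (T k)) (z : pt (T k)),
      cls_grp g2 = cls_grp f -> s2 (cls_pt z) = cls_pt (val f z)) ->
    cancel s2 s1.
  (* A representative of [y] may exist only at a later [j], so [g1] and [g2] are moved there, where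
     their product is still 1. *)
  move=> g12 s1P s2P y; have [j [ij [z ->]]] := cls_pt_above i y.
  rewrite (s2P j (on_grp (trans S ij) g2)) ?cls_grp_tr//.
  rewrite (s1P j (on_grp (trans S ij) g1)) ?cls_grp_tr//.
  congr cls_pt.
  have emb := trans_embedding S ij.
  have := embedding_grp_mul emb (etrans e1 (esym g12)).
  by rewrite (embedding_grp_one emb e1) => /(congr1 (@perm_fun _)) /(congr1 (@^~ z)).
have sK : cancel s t by apply: cancelP tP sP; rewrite hV mulVg.
have tK : cancel t s by apply: cancelP sP tP; rewrite hV mulgV.
by case: (no_s (Perm (Bijective sK tK))) => j f z; exact: sP.
Qed.

Lemma action_mul i (g h k : grp (T i)) : val k = val g * val h ->
  action (cls_grp k) = action (cls_grp g) * action (cls_grp h).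
Proof.
move=> ek; apply: Defs.permP => y; have [j [ij [x ->]]] := cls_pt_above i y.
rewrite /= -(cls_grp_tr ij k) -(cls_grp_tr ij g) -(cls_grp_tr ij h) !action_cls.
by rewrite (embedding_grp_mul (trans_embedding S ij) ek).
Qed.

Lemma action_one i (g : grp (T i)) : val g = 1 -> action (cls_grp g) = 1.
Proof.
move=> g1; apply: (mulgI (action (cls_grp g))); rewrite mulg1.
by rewrite -(@action_mul i g g g)// g1 mulg1.
Qed.

(** The classes may gain members at later indices, so each point is tested at an index [j] where it
    is represented; clause (c) gives the equation there. *)
Lemma action_members i (g : grp (T i)) (X Y : fam (T i)) : val Y = val g @` val X ->
  members (cls_fam Y) = action (cls_grp g) @` members (cls_fam X).
Proof.
move=> eY.
have trY j (ij : (i <= j)%O) : val (on_fam (trans S ij) Y) =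
    val (on_grp (trans S ij) g) @` val (on_fam (trans S ij) X).
  by have [_ _ _ /(_ g)[_ famP] _] := trans_embedding S ij; exact: famP.
apply/seteqP; split=> [y|_ [z + <-]].
  have [j [ij [y0 ->]]] := cls_pt_above i y.
  rewrite -(cls_fam_tr ij Y) members_cls trY => -[z Xz <-].
  exists (cls_pt z); first by rewrite -(cls_fam_tr ij X) members_cls.
  by rewrite -(cls_grp_tr ij) action_cls.
have [j [ij [z0 ->]]] := cls_pt_above i z.
rewrite -(cls_fam_tr ij X) -(cls_fam_tr ij Y) -(cls_grp_tr ij) action_cls !members_cls.
by move=> Xz; rewrite trY; exists z0.
Qed.

Lemma action_cls_inj i : injective (fun g : grp (T i) => action (cls_grp g)).
Proof.
move=> g h /= egh; apply: val_inj; apply: Defs.permP => x.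
by apply: cls_pt_inj; rewrite -!action_cls egh.
Qed.

Lemma range_action_subgroup : is_subgroup (range action).
Proof.
have [i0] := dirI.1; split.
  by have [e /action_one e1] := grp_one (T i0); apply: mem_set; exists (cls_grp e).
move=> _ _ /set_mem[c _ <-] /set_mem[c' _ <-]; apply: mem_set.
have [i [_ [g0 ->]]] := cls_grp_above i0 c.
have [j [ij [h ->]]] := cls_grp_above i c'.
rewrite -(cls_grp_tr ij g0); move: (on_grp _ g0) => g.
have [k ek] := grp_div g h; exists (cls_grp k) => //.
(* Multiplying by the action of [h] turns the quotient into the product k * h = g, to which
   [action_mul] applies. *)
apply: (mulIg (action (cls_grp h))); rewrite mulgVK.
by rewrite -(@action_mul j k h g)// ek mulgVK.
Qed.

Lemma range_action_members (c : lim_grp dirI S) (Y : lim_fam dirI S) :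
  range members (action c @` members Y).
Proof.
have [i0] := dirI.1.
have [i [_ [g0 ->]]] := cls_grp_above i0 c.
have [j [ij [X ->]]] := cls_fam_above i Y.
rewrite -(cls_grp_tr ij g0); move: (on_grp _ g0) => g.
have [Z eZ] := grp_fam g X; exists (cls_fam Z) => //; exact: action_members.
Qed.

(** Each permutation in the range maps F* into itself; the converse implication is the same fact for
    its inverse, which the subgroup property supplies. *)
Lemma range_action_Aut : range action `<=` Aut (range members).
Proof.
move=> s sG; have /set_mem[c _ es] : s \in range action by exact: mem_set.
move=> X; split=> [[Y _ <-]|[Y _ eY]].
  by rewrite -es; exact: range_action_members.
have /set_mem[c' _ es'] : s^-1 \in range action.
  by apply: (group_closedV range_action_subgroup); exact: mem_set.
have -> : X = (s^-1 : perm _)%g @` (s @` X).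
  have sK : cancel s (s^-1 : perm _)%g.
    by move=> x; rewrite -[LHS]/((s^-1 * s : perm _)%g x) mulVg.
  by rewrite image_comp (eq_imagel (fun x _ => sK x)) image_id.
by rewrite -eY -es'; exact: range_action_members.
Qed.

(** * Values of the limit homomorphism on generators *)

Lemma lim_phi_gen_cls i (d : dem (T i)) (g : grp (T i)) :
  phi_dom d -> val g = phi (free_gen d) ->
  lim_phi_gen (can_dem dirI d) = action (cls_grp g).
Proof.
move=> dd eg; rewrite /lim_phi_gen; case: xgetP => [s _|no_s]; last first.
  by case: (no_s (action (cls_grp g))); exists i, d, g.
(* Independence of the representative: equal components mean equal classes, so [d] and [e] meet at
   some [k], where clause (d) makes the images of [g] and [h] the same value of [phi]. *)
move=> [j [e [h [de /(congr1 val)/components_inj/cls_dem_eq ede eh ->]]]].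
have [k [ik [jk ek]]] := ede; rewrite /= -(cls_grp_tr ik) -(cls_grp_tr jk).
congr (action (cls_grp _)); apply: val_inj.
have [_ _ _ _ /(_ _ dd)[_ ->//]] := trans_embedding S ik.
by have [_ _ _ _ /(_ _ de)[_ ->//]] := trans_embedding S jk; rewrite ek.
Qed.

Lemma action_satisfies i (g : grp (T i)) (d : dem (T i)) :
  satisfies (val g) (val d) -> satisfies (action (cls_grp g)) (components (cls_dem d)).
Proof.
move=> [gpt gset]; split=> x y.
  by rewrite pt_graph_components => -[[x0 y0] /gpt <- [<- <-]] /=; rewrite action_cls.
rewrite set_graph_components => -[[X Y] /= /gset eY [<- <-]].
exact/esym/action_members.
Qed.

(** * The demands on the limit family *)

Lemma components_is_demand (c : lim_dem dirI S) :
  is_demand (range members) (components c).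
Proof.
have [i0] := dirI.1; have [i [_ [d ->]]] := cls_dem_above i0 c.
have [fin_pt fin_set famd memd] := dem_is_demand d; split.
- rewrite pt_graph_components.
  exact: finite_partial_injection_image (@cls_pt_inj i) fin_pt.
- rewrite set_graph_components.
  apply: finite_partial_injection_image (@members_cls_inj i) _.
  exact: finite_partial_injection_preimage val_inj fin_set.
- move=> X Y; rewrite set_graph_components => -[[X0 Y0] _ [<- <-]].
  by split; [exists (cls_fam X0)|exists (cls_fam Y0)].
- move=> x y X Y; rewrite pt_graph_components set_graph_components.
  move=> [[x0 y0] /= dxy [<- <-]] [[X0 Y0] /= dXY [<- <-]].
  by rewrite !members_cls; exact: memd dxy dXY.
Qed.

(** Finiteness of both graphs yields one index [k] representing every point and set in them; [e] is
    then pulled back to a demand on F_k. *)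
Lemma demand_components (e : predemand (lim_pt dirI S)) :
  is_demand (range members) e -> range components e.
Proof.
move=> [pt_e set_e fam_e mem_e].
have [i ptP] : exists i, forall p, pt_graph e p ->
    exists x y : pt (T i), p = (cls_pt x, cls_pt y).
  apply: (finite_directed dirI) => [i j p ij [x [y ->]]||[x y] _].
  - by exists (on_pt (trans S ij) x), (on_pt (trans S ij) y); rewrite !cls_pt_tr.
  - by case: pt_e.
  - have [i0] := dirI.1; have [i [_ [x0 ->]]] := cls_pt_above i0 x.
    have [j [ij [y0 ->]]] := cls_pt_above i y.
    by exists j, (on_pt (trans S ij) x0), y0; rewrite cls_pt_tr.
have [j setP] : exists i, forall p, set_graph e p ->
    exists X Y : fam (T i), p = (members (cls_fam X), members (cls_fam Y)).
  apply: (finite_directed dirI) => [k j p kj [X [Y ->]]||[X Y] /fam_e].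
  - by exists (on_fam (trans S kj) X), (on_fam (trans S kj) Y); rewrite !cls_fam_tr.
  - by case: set_e.
  - move=> [[X1 _ <-] [Y1 _ <-]].
    have [k [_ [X0 ->]]] := cls_fam_above i X1.
    have [j [kj [Y0 ->]]] := cls_fam_above k Y1.
    by exists j, (on_fam (trans S kj) X0), Y0; rewrite cls_fam_tr.
have [k [ik jk]] := dirI.2 i j.
(* The pullback of the set graph lives on the subtype [fam (T k)], so [d0] pushes it along [val].
   Injectivity of the class maps at [k] keeps both graphs partial injections. *)
pose rF := (fun p : fam (T k) * fam (T k) =>
  (members (cls_fam p.1), members (cls_fam p.2))) @^-1` set_graph e.
pose d0 := Predemand ((fun p : pt (T k) * pt (T k) =>
  (cls_pt p.1, cls_pt p.2)) @^-1` pt_graph e) ((fun p => (val p.1, val p.2)) @` rF).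
have [d ed] : exists d : dem (T k), val d = d0.
  apply: set_elt; apply/demE; split => /=.
  - exact: finite_partial_injection_preimage (@cls_pt_inj k) pt_e.
  - apply: finite_partial_injection_image val_inj _.
    exact: finite_partial_injection_preimage (@members_cls_inj k) set_e.
  - by move=> _ _ [[X Y] _ [<- <-]]; split; [exact: set_mem (valP X)|exact: set_mem (valP Y)].
  - move=> x y _ _ exy [[X Y] eXY [<- <-]]; rewrite -!members_cls.
    exact: mem_e exy eXY.
exists (cls_dem d) => //.
(* The pullback maps into [e] by construction; [ptP], moved from [i] to [k], shows that no pair of
   [e] is lost. Below, [setP] does the same for sets from [j]. *)
have ept : pt_graph (components (cls_dem d)) = pt_graph e.
  rewrite pt_graph_components ed /=; apply/seteqP; split=> [_ [p ep <-]//|p ep].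
  have [x [y ep']] := ptP p ep; exists (on_pt (trans S ik) x, on_pt (trans S ik) y);
    by rewrite /= !cls_pt_tr -ep'.
have eset : set_graph (components (cls_dem d)) = set_graph e.
  rewrite set_graph_components ed; apply/seteqP; split.
    move=> _ [[X Y] [[X' Y'] eXY exy] <-] /=.
    by have [<- <-] := pair_map_injective val_inj exy.
  move=> p ep; have [X [Y ep']] := setP p ep.
  exists (on_fam (trans S jk) X, on_fam (trans S jk) Y);
    last by rewrite /= !cls_fam_tr -ep'.
  exists (on_fam (trans S jk) X, on_fam (trans S jk) Y) => //.
  by rewrite /rF /= !cls_fam_tr -ep'.
by case: (components _) (e) ept eset => [? ?] [? ?] /= -> ->.
Qed.

Lemma demands_range_members : demands (range members) = range components.
Proof.
apply/seteqP; split=> [e /demand_components//|_ [c _ <-]].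
exact: components_is_demand.
Qed.

(** * The canonical maps *)

Lemma canonical_embedding i : multi_embedding (canonical_map dirI S i).
Proof.
split.
- split; last by move=> g h k ek; exact: action_mul.
  split; first exact: cls_pt_inj.
  + by move=> X Y /(congr1 val)/members_cls_inj.
  + by move=> d e /(congr1 val)/components_cls_inj.
  + by move=> g h /(congr1 val)/action_cls_inj.
- by move=> x X /=; split=> /members_cls.
- move=> d; split; rewrite -[val (on_dem _ d)]/(components (cls_dem d)).
  + rewrite pt_graph_components; apply/seteqP; split.
      by move=> _ [x [y dxy] <-]; exists (cls_pt y), (x, y).
    by move=> _ [_ [[x y] /= dxy [<- _]]]; exists x => //; exists y.
  + rewrite set_graph_components; apply/seteqP; split.
      move=> _ [X [Y dXY] <-]; have [_ [Y' [_ eY]]] := fam_set_graph dXY.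
      by rewrite {}eY in dXY; exists (members (cls_fam Y')), (X, Y').
    by move=> _ [_ [[X Y] /= dXY [<- _]]]; exists X => //; exists (val Y).
  + by move=> x y dxy; rewrite pt_graph_components; exists (x, y).
  + by move=> X Y dXY; rewrite set_graph_components; exists (X, Y).
- move=> g; split=> [x|X Y eY] /=; first by rewrite action_cls.
  exact: action_members.
- move=> d dd; split; first by exists i, d.
  by move=> g eg; rewrite /= free_extension_gen (lim_phi_gen_cls dd eg).
Qed.

(** * Consequences of success *)

Hypothesis succS : successful_system S.

(** A successful transition map moves an arbitrary representative into the domain of [phi] without
    changing its class. *)
Lemma lim_demandP (e : range components) : exists i (d : dem (T i)) (g : grp (T i)),
  [/\ phi_dom d, e = can_dem dirI d & val g = phi (free_gen d)].
Proof.
have [c _ ec] := set_mem (valP e); have [i0] := dirI.1.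
have [i [_ [d0 ed]]] := cls_dem_above i0 c.
have [j [ij [_ dom_d]]] := succS i.
have [g eg] := grp_phi (dom_d d0).
exists j, (on_dem (trans S ij) d0), g; split => //.
by apply: val_inj; rewrite -[LHS]ec ed /= cls_dem_tr.
Qed.

Lemma lim_phi_gen_satisfies (e : range components) :
  range action (lim_phi_gen e) /\ satisfies (lim_phi_gen e) (val e).
Proof.
have [i [d [g [dd -> eg]]]] := lim_demandP e; rewrite (lim_phi_gen_cls dd eg).
split; first by exists (cls_grp g).
apply: action_satisfies; rewrite eg.
by have [_ _ _ _ satP] := structureP (T i); exact: satP.
Qed.

Lemma lim_phi_dom_total (e : range components) : lim_phi_dom e.
Proof. by have [i [d [_ [dd -> _]]]] := lim_demandP e; exists i, d. Qed.

Lemma limit_is_structure : is_structure (limit dirI S).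
Proof.
split.
- exact/esym/demands_range_members.
- by split; [exact: range_action_Aut|exact: range_action_subgroup].
(* Values on words are products of generator values and their inverses, so it suffices that G* is a
   subgroup containing the generator values. *)
- move=> u _; apply: free_extension_closed; first exact: range_action_subgroup.
  by move=> e; case: (lim_phi_gen_satisfies e).
- by move=> u v _ _; exact: free_extensionM.
- move=> e _; rewrite /= free_extension_gen.
  by case: (lim_phi_gen_satisfies e).
Qed.
End Limit.

Theorem theorem2p3 (disp : Order.disp_t) (I : preorderType disp)
    (dirI : directed I) (S : direct_system I) (succS : successful_system S) :
  let Tstar := limit dirI S in
  [/\ is_structure Tstar,
      homogeneous (fam Tstar),
      dem Tstar = demands (fam Tstar),
      forall d : dem Tstar,
        [/\ phi_dom d, grp Tstar (phi (free_gen d)),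
            Aut (fam Tstar) (phi (free_gen d))
          & satisfies (phi (free_gen d)) (val d)]
    & forall i : I, successful_embedding (canonical_map dirI S i)].
Proof.
move=> Tstar.
have phiP (d : dem Tstar) :
    [/\ phi_dom d, grp Tstar (phi (free_gen d)),
        Aut (fam Tstar) (phi (free_gen d))
      & satisfies (phi (free_gen d)) (val d)].
  have [gd sd] := lim_phi_gen_satisfies succS d.
  rewrite /= free_extension_gen; split => //; first exact: lim_phi_dom_total.
  exact: range_action_Aut.
split; [exact: limit_is_structure| |exact/esym/demands_range_members|exact: phiP|].
  (* A demand on F* is an element of D*, so its value under the limit homomorphism is the required
     automorphism. *)
  move=> e /demand_components /(@set_elt _ (dem Tstar))[d <-].
  by have [_ _ autd satd] := phiP d; exists (phi (free_gen d)).
move=> i; split; first exact: canonical_embedding.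
by move=> d; exact: lim_phi_dom_total.
Qed.
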